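(* Let $d$ be a positive integer, $U\subseteq\mathbb R$ an open interval and take distinct points $\lambda_1,\ldots,\lambda_{d+1}$ in $U$. If $f \in P_d(U)$ then all eigenvalues of the real symmetric $(d+1)\times(d+1)$ matrix whose $(i,j)$ entry is $$\sqrt{\frac{\left(\frac{f(\lambda_i)-f(\lambda_j)}{\lambda_i-\lambda_j}\right)^2}{Df(\lambda_i)\,Df(\lambda_j)}}\quad\text{for } i\neq j,$$ and whose diagonal entries are equal to $1$, are non-negative.
   Context: $D$ denotes differentiation. Padé approximants and Schwarzian derivatives: a rational map is a quotient $p/q$ of polynomials with $q \not\equiv 0$; its degree is $\max(\deg p,\deg q)$ when $p,q$ are relatively prime. Let $k \ge 0$ be an integer and $g$ a real-valued function which is $2k$ times differentiable at a real point $y$. The $k$'th Padé approximant to $g$ at $y$, denoted $[g]_y^k$, is the rational map $\mathcal R$ of degree at most $k$ (finite at $y$) with $D^j\mathcal R(y) = D^j g(y)$ for $0 \le j \le 2k$, if such a map exists (it is then unique). If moreover $g$ is $2k+1$ times differentiable at $y$, $Dg(y) \ne 0$, $k\ge 1$, and $\mathcal R = [g]_y^k$ exists, the Schwarzian derivative of order $k$ is $S_k(g)(y) = D^{2k+1}(\mathcal R^{-1}\circ g)(y)$, where $\mathcal R^{-1}$ is the local inverse of $\mathcal R$ sending $g(y)$ to $y$; equivalently $S_k(g)(y) = D^{2k+1}(g-\mathcal R)(y)/Dg(y)$. We say $S_k(g)(y)$ exists when $[g]_y^k$ exists. For an open interval $U$, $P_d(U)$ is the set of functions $f:U\to\mathbb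 R$ which are $2d+1$ times differentiable with $Df \ne 0$ everywhere on $U$ and such that, for every $x\in U$ and $1\le k\le d$, $S_k(f)(x)$ exists and $S_k(f)(x)\ge 0$. (Since derivatives have the intermediate value property, $Df$ has constant sign on $U$, so the expression under the square root is non-negative.) *)

(* Defs.v *)
From HB Require Import structures.
From mathcomp Require Import all_boot all_order all_algebra.
From mathcomp Require Import all_classical all_reals all_analysis.

Set Implicit Arguments.
Unset Strict Implicit.
Unset Printing Implicit Defensive.

Import Order.TTheory GRing.Theory Num.Theory.
Import numFieldNormedType.Exports.

Local Open Scope ring_scope.
Local Open Scope classical_set_scope.

(* [f] is [n] times differentiable at the point [x]: the derivatives of order
   less than [n] exist on a neighbourhood of [x], and the last of them is
   differentiable at [x] (but need not be so around [x]). *)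
Fixpoint nderivable (R : realType) (n : nat) (f : R -> R) (x : R) : Prop :=
  if n is m.+1 then
    (\forall z \near x, nderivable m f z) /\ derivable (f^`(m)) x 1
  else True.

(* A rational map is given by a numerator and a denominator.  At the poles this
   function takes the junk value 0, but it is only used near points where [q]
   does not vanish. *)
Definition ratmap (R : realType) (p q : {poly R}) : R -> R :=
  fun x => p.[x] / q.[x].

(* The degree of the rational map [p / q], for [p] and [q] coprime. *)
Definition ratdeg (R : realType) (p q : {poly R}) : nat :=
  maxn (size p).-1 (size q).-1.

(* [p / q], in lowest terms, is the [k]-th Pade approximant to [g] at [y].
   That [q] is non-zero follows from [pade_finite]. *)
Record is_pade (R : realType) (k : nat) (g : R -> R) (y : R)
    (p q : {poly R}) : Prop := {
  pade_nderivable : nderivable (2 * k) g y;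
  pade_coprime : coprimep p q;
  pade_degree : (ratdeg p q <= k)%N;
  pade_finite : q.[y] != 0;
  pade_agree : forall j : nat, (j <= 2 * k)%N ->
    (ratmap p q)^`(j) y = g^`(j) y }.

(* [h] is an inverse of [r] as a germ from [r y] to [y]; in particular
   [h (r y) = y]. *)
Definition is_local_inverse (R : realType) (r : R -> R) (y : R) (h : R -> R)
    : Prop :=
  (\forall x \near y, h (r x) = x) /\ (\forall w \near r y, r (h w) = w).

(* The Schwarzian derivative of order [k] of [g] at [y] exists and equals [s].
   The approximant [p / q] is unique as a rational map.  Its derivative at [y]
   is that of [g], hence non-zero, so that the germ of [h] at [g y] exists and
   is unique: there is exactly one such [s] as soon as there is a Pade
   approximant. *)
Record is_schwarzian (R : realType) (k : nat) (g : R -> R) (y s : R) : Prop := {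
  schwarzian_order : (0 < k)%N;
  schwarzian_nderivable : nderivable (2 * k).+1 g y;
  schwarzian_deriv_neq0 : g^`() y != 0;
  schwarzianE : exists p q : {poly R}, exists h : R -> R,
    [/\ is_pade k g y p q,
        is_local_inverse (ratmap p q) y h &
        (h \o g)^`((2 * k).+1) y = s] }.

(* The class P_d(U).  For [U] open, this only depends on the values of [f] on
   [U]. *)
Record Pclass (R : realType) (d : nat) (U : set R) (f : R -> R) : Prop := {
  Pclass_nderivable : forall x, U x -> nderivable (2 * d).+1 f x;
  Pclass_deriv_neq0 : forall x, U x -> f^`() x != 0;
  Pclass_schwarzian_ge0 : forall x, U x -> forall k, (1 <= k <= d)%N ->
    exists2 s, is_schwarzian k f x s & 0 <= s }.

Definition dquot_mx (R : realType) (n : nat) (f : R -> R) (lambda : 'I_n -> R)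
    : 'M[R]_n :=
  \matrix_(i, j)
    if i == j then 1
    else Num.sqrt (((f (lambda i) - f (lambda j)) / (lambda i - lambda j)) ^+ 2
                   / (f^`()%classic (lambda i) * f^`()%classic (lambda j))).

(* Main.v *)
(* Up to the constant sign of the derivative and a diagonal congruence, the matrix
   is that of the divided differences L_ij of f, with L_ii = Df(lambda_i).  With
   q = sum_i c_i prod_(m != i) (x - lambda_m), the quadratic form
   sum_ij c_i c_j L_ij is the divided difference of f q^2 at the points lambda_m,
   each counted twice.  By Rolle it is therefore the coefficient of order 2d+1 of
   the Taylor expansion of f q^2 at some point x of U.  At such a point
   f q_k = p_k + (S_k(f)(x) / (2k+1)!) Df(x) q_k(x) X^(2k+1) + ..., where p_k / q_k
   is the k-th Pade approximant.  Splitting off from q a multiple of q_d, then from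
   the quotient of the rest by X a multiple of q_(d-1), and so on, writes Df(x)
   times that coefficient as a sum of squares weighted by 1, S_1(f)(x), ...,
   S_d(f)(x). *)
Require Import Defs.
From HB Require Import structures.
From mathcomp Require Import all_boot all_order all_algebra.
From mathcomp Require Import all_classical all_reals all_analysis.
From mathcomp Require Import ring zify.

Set Implicit Arguments.
Unset Strict Implicit.
Unset Printing Implicit Defensive.

Import Order.TTheory GRing.Theory Num.Theory.
Import numFieldNormedType.Exports.

Local Open Scope ring_scope.
Local Open Scope classical_set_scope.

(** * Finite Taylor expansions and their algebra *)

Section HigherDerivatives.
Variable R : realType.
Implicit Types (f g : R -> R) (x : R) (n : nat).

Lemma derive1nSr f n : f^`(n.+1) = (f^`())^`(n).
Proof. by rewrite /derive1n iterSr. Qed.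

Lemma near_eq_derive1n f g x n : (\forall z \near x, f z = g z) ->
  \forall z \near x, f^`(n) z = g^`(n) z.
Proof.
move=> fg; elim: n => [|n IH]; first exact: fg.
rewrite !derive1nS; move/near_join: IH; apply: filterS => z fgz.
by rewrite !derive1E; apply: near_eq_derive.
Qed.

Lemma near_eq_nderivable f g x n : (\forall z \near x, f z = g z) ->
  nderivable n f x -> nderivable n g x.
Proof.
elim: n x => [//|n IH] x fg /= [fn dfn]; split.
  move/near_join: fg => fg; near=> z; apply: IH; first by near: z.
  by near: z.
by apply: near_eq_derivable dfn; apply: near_eq_derive1n.
Unshelve. all: by end_near. Qed.

(** [nderivable] peels off the last derivative, whereas inductions on products, inverses and
    compositions need to peel off the first. The guard [0 < n] reflects that a single derivative at
    [x] says nothing about nearby points. *)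
Lemma nderivableSP n f x : nderivable n.+1 f x <->
  [/\ derivable f x 1, (0 < n)%N -> \forall z \near x, derivable f z 1
    & nderivable n f^`() x].
Proof.
elim: n x => [|n IH] x.
  by split=> [[_ df]|[df _ _]]; split=> //; exact: filterE.
split=> [[fn dfn]|[df /(_ isT) ndf [fn dfn]]].
  have nf : \forall z \near x, derivable f z 1.
    by apply: filterS fn => z /IH[].
  split=> //; first exact: nbhs_singleton nf.
  split; last by rewrite -derive1nSr.
  by apply: filterS fn => z /IH[].
split; last by rewrite derive1nSr.
move/near_join: ndf => ndf.
near=> z; apply/IH; split; last by near: z.
  by apply: (@nbhs_singleton _ _ (fun z => derivable f z 1)); near: z.
by move=> _; near: z.
Unshelve. all: by end_near. Qed.

Lemma nderivableW m n f x : (m <= n)%N -> nderivable n f x -> nderivable m f x.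
Proof.
move=> /subnK <-; elim: (n - m)%N => [//|k IH]; rewrite addSn => /= -[fn _].
by apply: IH; exact: nbhs_singleton fn.
Qed.

Lemma nderivable_derivable n f x : (0 < n)%N -> nderivable n f x ->
  derivable f x 1.
Proof. by move=> n0 /(nderivableW n0)[]. Qed.

(* [P] is the Taylor expansion of [f] at [x] up to order [n]; its coefficients
   beyond [n] are arbitrary. *)
Definition jet n f x (P : {poly R}) : Prop :=
  nderivable n f x /\ forall i, (i <= n)%N -> f^`(i) x = P`_i *+ i`!.

Lemma jetSP n f x P : jet n.+1 f x P <->
  [/\ f x = P`_0, derivable f x 1,
      (0 < n)%N -> \forall z \near x, derivable f z 1
    & jet n f^`() x P^`()%R].
Proof.
split=> [[/nderivableSP[df ndf nf] fP]|[f0 df ndf [nf fP]]].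
  split=> //; first by rewrite -[LHS]/(f^`(0) x) fP // mulr1n.
  by split=> // i ni; rewrite -derive1nSr fP// coef_deriv -mulrnA factS.
split; first exact/nderivableSP.
case=> [_|i ni]; first by rewrite derive1n0 f0.
by rewrite derive1nSr fP// coef_deriv -mulrnA factS.
Qed.

Lemma jetW m n f x P : (m <= n)%N -> jet n f x P -> jet m f x P.
Proof.
move=> mn [nf fP]; split; first exact: nderivableW nf.
by move=> i im; apply: fP; apply: leq_trans mn.
Qed.

Lemma jet_near n f g x P : (\forall z \near x, f z = g z) ->
  jet n f x P -> jet n g x P.
Proof.
move=> fg [nf fP]; split; first exact: near_eq_nderivable nf.
move=> i ni; rewrite -fP//; apply/esym.
exact: (nbhs_singleton (near_eq_derive1n i fg)).
Qed.

Lemma jet_unique n f x P Q : jet n f x P -> jet n f x Q ->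
  forall i, (i <= n)%N -> P`_i = Q`_i.
Proof.
move=> [_ fP] [_ fQ] i ni; apply: (pmulrnI (fact_gt0 i)).
by rewrite -fP// fQ.
Qed.

Lemma nderivable_jet n f x : nderivable n f x -> exists P, jet n f x P.
Proof.
move=> nf; exists (\poly_(i < n.+1) ((f^`(i))%classic x / i`!%:R)); split=> // i ni.
rewrite coef_poly ltnS ni -[RHS]mulr_natr divfK//.
Qed.

(* For [n = 0] nothing is assumed around [x]: [f] need not be differentiable
   there. *)
Lemma jet_deriv n f g x (P : {poly R}) : (f x = P`_0) -> derivable f x 1 ->
  ((0 < n)%N -> \forall z \near x, derivable f z 1) ->
  f^`() x = g x -> ((0 < n)%N -> \forall z \near x, f^`() z = g z) ->
  jet n g x P^`()%R -> jet n.+1 f x P.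
Proof.
move=> f0 df ndf fg nfg jg; apply/jetSP; split=> //.
case: n ndf nfg jg => [|n] ndf nfg jg.
  by case: jg => _ /(_ 0%N isT) gP; split=> // -[]//; rewrite derive1n0 fg -gP.
by apply: jet_near jg; apply: filterS (nfg isT) => z ->.
Qed.

Lemma jet0P f x P : jet 0 f x P <-> f x = P`_0.
Proof.
split=> [[_ /(_ 0%N isT)] //|fP]; split=> // i; rewrite leqn0 => /eqP ->.
by rewrite derive1n0 fP.
Qed.

Lemma jetC n c x : jet n (cst c) x c%:P.
Proof.
elim: n c => [|n IH] c; first by apply/jet0P; rewrite coefC.
apply: (@jet_deriv _ _ (cst 0)); rewrite ?coefC ?derivC//.
- by move=> _; near=> z; exact: derivable_cst.
- exact: derive1_cst.
- by move=> _; near=> z; exact: derive1_cst.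
Unshelve. all: by end_near. Qed.

Lemma jet_id n x : jet n id x (x%:P + 'X).
Proof.
case: n => [|n]; first by apply/jet0P; rewrite coefD coefC coefX addr0.
apply: (@jet_deriv _ _ (cst 1)); rewrite ?coefD ?coefC ?coefX ?addr0//.
- by move=> _; near=> z; exact: derivable_id.
- by rewrite derive1E derive_id.
- by move=> _; near=> z; rewrite derive1E derive_id.
- by rewrite derivD derivC derivX add0r; exact: jetC.
Unshelve. all: by end_near. Qed.

Lemma jetD n f g x P Q : jet n f x P -> jet n g x Q ->
  jet n (fun z => f z + g z) x (P + Q).
Proof.
elim: n f g P Q => [|n IH] f g P Q.
  by move=> /jet0P fP /jet0P gQ; apply/jet0P; rewrite coefD fP gQ.
move=> /jetSP[f0 df ndf jf] /jetSP[g0 dg ndg jg].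
have D z : derivable f z 1 -> derivable g z 1 ->
    derivable (fun z => f z + g z) z 1 /\
    (fun z => f z + g z)^`() z = f^`()%classic z + g^`()%classic z.
  move=> dfz dgz; split; first exact: derivableD.
  by rewrite !derive1E; apply: deriveD.
apply: (@jet_deriv _ _ (fun z => f^`()%classic z + g^`()%classic z)).
- by rewrite coefD f0 g0.
- by have [] := D _ df dg.
- move=> n0; move: (ndf n0) (ndg n0); apply: filterS2 => z dfz dgz.
  by have [] := D _ dfz dgz.
- by have [] := D _ df dg.
- move=> n0; move: (ndf n0) (ndg n0); apply: filterS2 => z dfz dgz.
  by have [] := D _ dfz dgz.
- by rewrite derivD; apply: IH.
Qed.

Lemma jetM n f g x P Q : jet n f x P -> jet n g x Q ->
  jet n (fun z => f z * g z) x (P * Q).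
Proof.
elim: n f g P Q => [|n IH] f g P Q.
  by move=> /jet0P fP /jet0P gQ; apply/jet0P; rewrite coef0M fP gQ.
move=> jf' jg'; have jfn := jetW (leqnSn n) jf'; have jgn := jetW (leqnSn n) jg'.
move/jetSP: jf' => [f0 df ndf jf]; move/jetSP: jg' => [g0 dg ndg jg].
have D z : derivable f z 1 -> derivable g z 1 ->
    derivable (fun z => f z * g z) z 1 /\
    (fun z => f z * g z)^`() z = f^`()%classic z * g z + f z * g^`()%classic z.
  move=> dfz dgz; split; first exact: derivableM.
  rewrite !derive1E; have -> := deriveM dfz dgz.
  by rewrite addrC; congr (_ + _); rewrite -[LHS]/(_ * _) mulrC.
apply: (@jet_deriv _ _ (fun z => f^`()%classic z * g z + f z * g^`()%classic z)).
- by rewrite coef0M f0 g0.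
- by have [] := D _ df dg.
- move=> n0; move: (ndf n0) (ndg n0); apply: filterS2 => z dfz dgz.
  by have [] := D _ dfz dgz.
- by have [] := D _ df dg.
- move=> n0; move: (ndf n0) (ndg n0); apply: filterS2 => z dfz dgz.
  by have [] := D _ dfz dgz.
- by rewrite derivM; apply: jetD; apply: IH.
Qed.

Lemma jet_horner n f x P (p : {poly R}) : jet n f x P ->
  jet n (fun z => p.[f z]) x (p \Po P).
Proof.
move=> jf; elim/poly_ind: p => [|p c IH].
  rewrite comp_poly0 -polyC0; apply: jet_near (jetC n 0 x).
  by near=> z; rewrite horner0.
rewrite comp_polyD comp_polyM comp_polyX comp_polyC.
apply: jet_near (jetD (jetM IH jf) (jetC n c x)).
by near=> z; rewrite hornerMXaddC.
Unshelve. all: by end_near. Qed.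

Lemma jet_poly n x (p : {poly R}) : jet n (horner p) x (p \Po (x%:P + 'X)).
Proof. exact: jet_horner (jet_id n x). Qed.

Lemma nderivableM n f g x : nderivable n f x -> nderivable n g x ->
  nderivable n (fun z => f z * g z) x.
Proof.
by move=> /nderivable_jet[P jP] /nderivable_jet[Q jQ]; case: (jetM jP jQ).
Qed.

Lemma nderivable_horner n f x (p : {poly R}) : nderivable n f x ->
  nderivable n (fun z => p.[f z]) x.
Proof. by move=> /nderivable_jet[P jP]; case: (jet_horner p jP). Qed.

(** A polynomial expansion is not closed under inversion, so only differentiability is recorded. The
    derivative is a product of inverses of [f] and of the derivative of [f], to which the induction
    hypothesis applies one order lower. *)
Lemma nderivableV n f x : f x != 0 -> nderivable n f x ->
  nderivable n (fun z => (f z)^-1) x.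
Proof.
elim: n f => [//|n IH] f f0 nf.
have nfn := nderivableW (leqnSn n) nf.
move/nderivableSP: nf => [df ndf nf].
have D z : f z != 0 -> derivable f z 1 ->
    derivable (fun z => (f z)^-1) z 1 /\
    (fun z => (f z)^-1)^`() z = (-1 * (f z)^-1 * (f z)^-1) * f^`()%classic z.
  move=> fz0 dfz; split; first exact: derivableV.
  rewrite !derive1E deriveV//; rewrite -[LHS]/(_ * _); congr (_ * _).
  by rewrite mulN1r mulNr -invfM expr2.
have nz0 : \forall z \near x, f z != 0.
  have fc : f z @[z --> x] --> f x.
    exact/differentiable_continuous/derivable1_diffP.
  exact: cvgr_neq0 fc f0.
have [dV DV] := D _ f0 df.
apply/nderivableSP; split=> //.
  by move=> n0; move: nz0 (ndf n0); apply: filterS2 => z fz0 dfz; case: (D _ fz0 dfz).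
(* At order 0 nothing remains to prove; from order 1 on, [ndf] makes the formula for the derivative
   valid around [x], not only at [x]. *)
case: n IH nfn ndf nf => [//|n] IH nfn ndf nf.
apply: near_eq_nderivable (_ : nderivable _ (fun z =>
  (-1 * (f z)^-1 * (f z)^-1) * f^`()%classic z) x).
  by move: nz0 (ndf isT); apply: filterS2 => z fz0 dfz; case: (D _ fz0 dfz).
apply: nderivableM nf; apply: nderivableM (IH _ f0 nfn).
by apply: nderivableM (IH _ f0 nfn); case: (jetC n.+1 (-1) x).
Qed.

End HigherDerivatives.

(** * Differentiability of local inverses of rational maps *)

Section LocalInverse.
Variable R : realType.
Implicit Types (p q : {poly R}) (g h : R -> R) (x y : R).

Definition wronskian p q : {poly R} := p^`()%R * q - p * q^`()%R.

Lemma is_derive_ratmap p q x : q.[x] != 0 ->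
  is_derive x 1 (ratmap p q) ((wronskian p q).[x] / q.[x] ^+ 2).
Proof.
move=> q0; have dp := is_derive_poly p x; have dq := is_derive_poly q x.
apply: is_derive_eq (is_deriveM dp (is_deriveV q0 dq)) _.
rewrite -![_ *: _]/(_ * _) /wronskian !hornerE /=.
by field.
Qed.

Lemma near_horner_neq0 p x : p.[x] != 0 -> \forall z \near x, p.[z] != 0.
Proof.
move=> p0; have pc : p.[z] @[z --> x] --> p.[x] by apply: continuous_horner.
exact: cvgr_neq0 pc p0.
Qed.

Lemma local_inverse_derive p q h y : q.[y] != 0 -> (wronskian p q).[y] != 0 ->
  is_local_inverse (ratmap p q) y h ->
  \forall w \near ratmap p q y,
    [/\ q.[h w] != 0, (wronskian p q).[h w] != 0, ratmap p q (h w) = w,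
        derivable h w 1 & h^`() w = q.[h w] ^+ 2 / (wronskian p q).[h w]].
Proof.
move=> q0 W0 [hr rh].
have nq := near_horner_neq0 q0; have nW := near_horner_neq0 W0.
have dh : \forall x \near y, is_derive (ratmap p q x) 1 h
    ((wronskian p q).[x] / q.[x] ^+ 2)^-1.
  move/near_join: hr => hr; move/near_join: (nq) => nq'.
  near=> x.
  have qx0 : q.[x] != 0 by near: x.
  apply: is_derive_inverse (is_derive_ratmap p qx0) _.
  - by near: x.
  - have : \forall z \near x, q.[z] != 0 by near: x.
    apply: filterS => z qz0; apply/differentiable_continuous/derivable1_diffP.
    by case: (is_derive_ratmap p qz0).
  - by rewrite mulf_neq0 ?invr_eq0 ?expf_neq0//; near: x.
have hry : h (ratmap p q y) = y by exact: nbhs_singleton hr.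
(* So far the derivative of [h] is known at the points [ratmap p q x] with [x] near [y]. Continuity
   of [h] allows taking [x = h w], which reaches every [w] near [ratmap p q y]. *)
have hc : h w @[w --> ratmap p q y] --> y.
  rewrite -[X in _ --> X]hry; apply/differentiable_continuous/derivable1_diffP.
  by case: (nbhs_singleton dh).
move/hc: dh => dh; move/hc: nq => nq; move/hc: nW => nW.
near=> w.
have qw : q.[h w] != 0 by near: w.
have Ww : (wronskian p q).[h w] != 0 by near: w.
have rw : ratmap p q (h w) = w by near: w.
have : is_derive (ratmap p q (h w)) 1 h
    ((wronskian p q).[h w] / q.[h w] ^+ 2)^-1 by near: w.
rewrite rw => -[dw ew]; split=> //.
by rewrite derive1E ew invf_div.
Unshelve. all: by end_near. Qed.

(** A bootstrap: the derivative of [h \o g] is a rational expression in [h \o g] itself, times the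
    derivative of [g]. Hence [n] orders for [h \o g] and [n.+1] for [g] give [n.+1] orders for
    [h \o g]. *)
Lemma nderivable_local_inverse p q g h y n : q.[y] != 0 ->
  (wronskian p q).[y] != 0 -> is_local_inverse (ratmap p q) y h ->
  g y = ratmap p q y -> nderivable n g y -> nderivable n (h \o g) y.
Proof.
move=> q0 W0 rh gy; elim: n => [//|n IH] ng.
have nh := local_inverse_derive q0 W0 rh.
have hgn := IH (nderivableW (leqnSn n) ng).
move/nderivableSP: ng => [dg ndg ng].
have gc : g z @[z --> y] --> ratmap p q y.
  by rewrite -gy; exact/differentiable_continuous/derivable1_diffP.
move/gc: nh => nh.
have D z : derivable g z 1 -> q.[h (g z)] != 0 ->
    (wronskian p q).[h (g z)] != 0 -> derivable h (g z) 1 ->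
    h^`() (g z) = q.[h (g z)] ^+ 2 / (wronskian p q).[h (g z)] ->
    derivable (h \o g) z 1 /\ (h \o g)^`() z =
      (q ^+ 2).[h (g z)] * ((wronskian p q).[h (g z)])^-1 * g^`()%classic z.
  move=> dgz qz Wz dhz hz; split.
    apply/derivable1_diffP/differentiable_comp; exact/derivable1_diffP.
  by rewrite derive1_comp// hz horner_exp.
apply/nderivableSP; split.
- by have [qz Wz _ dhz hz] := nbhs_singleton nh; case: (D y).
- move=> n0; move: (ndg n0) nh; apply: filterS2 => z dgz [qz Wz _ dhz hz].
  by case: (D z).
case: n IH hgn ndg ng => [//|n] IH hgn ndg ng.
apply: near_eq_nderivable (_ : nderivable _ (fun z =>
  (q ^+ 2).[h (g z)] * ((wronskian p q).[h (g z)])^-1 * g^`()%classic z) y).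
  move: (ndg isT) nh; apply: filterS2 => z dgz [qz Wz _ dhz hz].
  by case: (D z).
apply: nderivableM ng; apply: nderivableM.
  exact: (nderivable_horner (f := h \o g)).
apply: nderivableV; first by have [] := nbhs_singleton nh.
exact: (nderivable_horner (f := h \o g)).
Qed.

End LocalInverse.

(** * Schwarzian derivatives as Taylor coefficients, and the reduction to a sum of squares *)

Section SchwarzianCoefficients.
Variable R : realType.
Implicit Types (p q P Q E V F : {poly R}).

(** The remainder keeps a factor [E ^+ 2]: when [E] has no constant term, the cofactor of [E] then
    has the same constant term as the derivative of [P]. *)
Lemma comp_poly_Taylor1 P E : exists B : {poly R},
  P \Po ('X + E) = P + E * (P^`()%R + E * B).
Proof.
elim/poly_ind: P => [|P c [B IH]].
  by exists 0; rewrite comp_poly0 deriv0; ring.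
exists (P^`()%R + B * 'X + E * B).
rewrite comp_polyD comp_polyM comp_polyX comp_polyC IH derivMXaddC.
by ring.
Qed.

Lemma coefM_low E V n : (forall i, (i < n)%N -> E`_i = 0) ->
  (E * V)`_n = E`_n * V`_0.
Proof.
move=> E0; rewrite coefM big_ord_recr /= subnn big1 ?add0r// => i _.
by rewrite E0 ?mul0r.
Qed.

Lemma coef_eq_low (A B : {poly R}) V n : (forall i, (i <= n)%N -> A`_i = B`_i) ->
  forall i, (i <= n)%N -> (A * V)`_i = (B * V)`_i.
Proof.
move=> AB i ni; rewrite !coefM; apply: eq_bigr => j _; rewrite AB//.
by apply: leq_trans ni; rewrite -ltnS.
Qed.

(** Clearing the denominator turns the expansion of a quotient into an identity between polynomials
    up to order [n]. *)
Lemma jet_ratmap p q y n S : q.[y] != 0 -> jet n (ratmap p q) y S ->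
  forall i, (i <= n)%N ->
  (S * (q \Po (y%:P + 'X)))`_i = (p \Po (y%:P + 'X))`_i.
Proof.
move=> q0 jS; apply: jet_unique (jet_poly n y p).
apply: jet_near (jetM jS (jet_poly n y q)).
by apply: filterS (near_horner_neq0 q0) => z qz; rewrite /ratmap divfK.
Qed.

(* Let [H = h \o f] and write its jet as [y + 'X + E].  Expanding the relation
   [p.[H] = f * q.[H]] around [y + 'X] gives [E * V = F * Q - P], where [P], [Q]
   are the translates of [p], [q], and [V`_0 = F`_1 * Q`_0 != 0]. *)
Lemma schwarzian_coef k f y s F :
  is_schwarzian k f y s -> jet (2 * k).+1 f y F ->
  exists p q, [/\ (size p <= k.+1)%N, (size q <= k.+1)%N, q`_0 != 0,
    forall i, (i <= 2 * k)%N -> (F * q)`_i = p`_i &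
    (F * q)`_(2 * k).+1 - p`_(2 * k).+1 =
      s / ((2 * k).+1)`!%:R * F`_1 * q`_0].
Proof.
case=> k0 nf f'0 [p [q [h [[nfk _ deg q0 pq] rh hs]]]] jF.
pose N : {poly R} := y%:P + 'X.
pose P : {poly R} := p \Po N; pose Q : {poly R} := q \Po N.
have szN : size N = 2 by rewrite /N addrC size_XaddC.
have Q0 : Q`_0 = q.[y].
  by rewrite -horner_coef0 horner_comp /N !hornerE.
move: deg; rewrite /ratdeg geq_max -!subn1 !leq_subLR !add1n => /andP[szp szq].
have nr n : nderivable n (ratmap p q) y.
  apply: nderivableM; first by case: (jet_poly n y p).
  by apply: nderivableV => //; case: (jet_poly n y q).
have [S jS] := nderivable_jet (nr (2 * k)%N).
have SF i : (i <= 2 * k)%N -> F`_i = S`_i.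
  apply: (jet_unique (n := (2 * k)%N) (jetW (leqnSn _) jF)); split=> // j jk.
  by rewrite -pq//; case: jS => _; apply.
have FQ i : (i <= 2 * k)%N -> (F * Q)`_i = P`_i.
  by move=> ik; rewrite (coef_eq_low _ SF)// (jet_ratmap q0 jS).
have k2 : (0 < 2 * k)%N by rewrite muln_gt0.
have F1 : F`_1 = f^`()%classic y.
  by case: jF => _ /(_ 1%N isT); rewrite derive1n1 mulr1n => ->.
have W0 : (wronskian p q).[y] != 0.
  have := pq 1%N k2; rewrite !derive1n1 derive1E.
  have [_ ->] := is_derive_ratmap p q0.
  by move=> e; move: f'0; rewrite -e; apply: contraNneq => ->; rewrite mul0r.
have fy : f y = ratmap p q y by have := pq 0%N isT; rewrite !derive1n0.
have nH := nderivable_local_inverse q0 W0 rh fy nf.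
have [G jG] := nderivable_jet nH.
pose E : {poly R} := G - N.
(* In this form, associativity of composition turns [p \Po G] and [q \Po G] into [P] and [Q]
   composed with ['X + E]. *)
have GE : G = N \Po ('X + E).
  by rewrite /N comp_polyD comp_polyC comp_polyX /E /N; ring.
have hy : h (f y) = y by rewrite fy; exact: (nbhs_singleton rh.1).
have E0 : E`_0 = 0.
  case: jG => _ /(_ 0%N isT); rewrite derive1n0 /= hy mulr1n => Gy.
  by rewrite /E coefB coefD coefC coefX /= addr0 -Gy subrr.
have En : E`_(2 * k).+1 = s / ((2 * k).+1)`!%:R.
  rewrite coefB coefD coefC coefX /= eqSS eqn0Ngt k2 addr0 subr0.
  case: jG => _ /(_ (2 * k).+1 (leqnn _)); rewrite hs => ->.
  by rewrite -[X in X / _]mulr_natr mulfK// pnatr_eq0 -lt0n fact_gt0.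
(* Both sides expand [p.[h (f z)]], because [ratmap p q (h w) = w] for [w] near [f y]. *)
have eqG : forall i, (i <= (2 * k).+1)%N -> (p \Po G)`_i = (F * (q \Po G))`_i.
  apply: jet_unique (jet_horner p jG) _.
  apply: jet_near (jetM jF (jet_horner q jG)).
  have fc : f z @[z --> y] --> ratmap p q y.
    rewrite -fy; apply/differentiable_continuous/derivable1_diffP.
    exact: nderivable_derivable nf.
  have nh : nbhs y (_ : set R) := fc _ (local_inverse_derive q0 W0 rh).
  apply: filterS nh => z /=.
  case=> qz _ + _ _; rewrite /ratmap /= => e.
  by rewrite -[X in X * _]e divfK.
have [B1 EB1] := comp_poly_Taylor1 P E.
have [B2 EB2] := comp_poly_Taylor1 Q E.
pose V : {poly R} := P^`()%R + E * B1 - F * (Q^`()%R + E * B2).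
have EV i : (i <= (2 * k).+1)%N -> (E * V)`_i = (F * Q)`_i - P`_i.
  move=> ik; apply/eqP; rewrite -subr_eq0; apply/eqP.
  transitivity ((p \Po G - F * (q \Po G))`_i).
    rewrite GE !comp_polyA -/P -/Q EB1 EB2 -!coefB.
    by congr ((_ : {poly R})`_i); rewrite /V; ring.
  by rewrite coefB eqG// subrr.
(* By [FQ] at order 1, the linear coefficient of [P] is that of [F * Q]; the part coming from the
   derivative of [Q] cancels. *)
have V0 : V`_0 = F`_1 * Q`_0.
  rewrite /V coefB coef0M !coefD !coef0M E0 !mul0r !addr0 !coef_deriv !mulr1n.
  rewrite -(FQ 1%N k2) coefM !big_ord_recr big_ord0 /= add0r.
  by rewrite subn0; ring.
have V0n : V`_0 != 0 by rewrite V0 mulf_neq0// ?F1// Q0.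
(* [E * V] vanishes up to order [2 * k] and [V] has a nonzero constant term, so [E] vanishes to the
   same order. At order [(2 * k).+1] only the product of the lowest coefficients is left. *)
have Elow i : (i < (2 * k).+1)%N -> E`_i = 0.
  elim/ltn_ind: i => i IH ik.
  have := EV i (ltnW ik); rewrite FQ// subrr coefM_low.
    by move/eqP; rewrite mulf_eq0 (negPf V0n) orbF => /eqP.
  by move=> j ji; apply: IH => //; exact: ltn_trans ik.
exists P, Q; split.
- by rewrite size_comp_poly2.
- by rewrite size_comp_poly2.
- by rewrite Q0.
- exact: FQ.
- by rewrite -EV// coefM_low// En V0 mulrA.
Qed.

End SchwarzianCoefficients.

(* Write [b = beta *: q + 'X * c].  Since [F * q] agrees with [p] up to order
   [2 * k], the mixed term and [beta ^+ 2 *: (p * q)] do not contribute; the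
   coefficient is the sum of [s * F`_1 * b`_0 ^+ 2] and of the coefficient of
   order [2 * k - 1] of [F * c ^+ 2]. *)
Lemma pade_form_ge0 (R : realType) (F : {poly R}) d :
  (forall k, (1 <= k <= d)%N -> exists p q : {poly R}, exists s,
    [/\ (size p <= k.+1)%N, (size q <= k.+1)%N, q`_0 != 0,
      forall i, (i <= 2 * k)%N -> (F * q)`_i = p`_i &
      (F * q)`_(2 * k).+1 - p`_(2 * k).+1 = s * F`_1 * q`_0 /\ 0 <= s]) ->
  forall b : {poly R}, (size b <= d.+1)%N ->
  0 <= F`_1 * (F * b ^+ 2)`_(2 * d).+1.
Proof.
elim: d => [|d IH] pade b szb.
  rewrite muln0 (size1_polyC szb) -polyC_exp coefMC mulrA -expr2.
  by rewrite mulr_ge0 ?sqr_ge0.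
have [|p [q [s [szp szq q0 Fq [Fqn s0]]]]] := pade d.+1; first by rewrite leqnn.
set k := d.+1 in szp szq Fq Fqn.
(* Chosen to cancel the constant term of [b], so that [r] is divisible by ['X]. *)
pose beta := b`_0 / q`_0.
pose r := b - beta *: q.
(* As [b] and [q] have degree at most [k], truncating at [k] loses nothing, and the quotient [c] has
   degree at most [d], as the induction requires. *)
pose c := \poly_(i < k) r`_i.+1.
have rE : r = c * 'X.
  apply/polyP => -[|i]; rewrite coefMX /=.
    by rewrite coefB coefZ divfK ?subrr.
  rewrite coef_poly; case: ltnP => // ki.
  by rewrite coefB coefZ !nth_default ?mulr0 ?subr0 // (leq_trans _ (_ : k < i.+1)%N).
have bE : b = beta *: q + c * 'X by rewrite -rE /r addrC subrK.
pose T := F * q - p.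
have T0 i : (i < (2 * k).+1)%N -> T`_i = 0.
  by move=> ik; rewrite coefB Fq// subrr.
have -> : F * b ^+ 2 = beta ^+ 2 *: (p * q) + beta ^+ 2 *: (T * q)
    + (2 * beta) *: (p * c * 'X) + (2 * beta) *: (T * c * 'X)
    + F * c ^+ 2 * 'X * 'X.
  by rewrite bE /T -!mul_polyC polyCM polyC_exp; ring.
have szc : (size c <= k)%N by exact: size_poly.
have X1 (A : {poly R}) : (A * 'X)`_(2 * k).+1 = A`_(2 * k) by rewrite coefMX.
have X2 (A : {poly R}) : (A * 'X * 'X)`_(2 * k).+1 = A`_(2 * d).+1.
  by rewrite X1 coefMX (_ : (2 * k)%N = (2 * d).+2)// /k; lia.
have Tc : (T * c)`_(2 * k) = 0.
  by rewrite coefM_low ?T0 ?mul0r// => i ik; rewrite T0// ltnW.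
have Tq : (T * q)`_(2 * k).+1 = s * F`_1 * q`_0 * q`_0.
  by rewrite (coefM_low q T0) coefB Fqn.
(* The degree bound on the approximant acts here: [p * q] has degree at most [2 * k], and [p * c] at
   most [2 * k - 1]. *)
have pq : (p * q)`_(2 * k).+1 = 0.
  by rewrite nth_default//; apply: leq_trans (size_polyMleq _ _) _; lia.
have pc : (p * c)`_(2 * k) = 0.
  by rewrite nth_default//; apply: leq_trans (size_polyMleq _ _) _; lia.
rewrite !coefD !coefZ X2 !X1 Tc Tq pq pc !mulr0 !addr0 add0r mulrDr addr_ge0//.
  rewrite (_ : _ * _ = s * (beta * F`_1 * q`_0) ^+ 2); last by ring.
  by rewrite mulr_ge0 ?sqr_ge0.
apply: IH => // j /andP[j1 jd]; apply: pade; rewrite j1 /=.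
exact: leq_trans jd _.
Qed.

(** * Counting zeros of derivatives by Rolle's theorem *)

Section Rolle.
Variables (R : realType) (U : set R).
Hypothesis itvU : is_interval U.
Implicit Types (g : R -> R) (x : R) (s : seq R).

(** One new zero is taken in each gap of the increasing list. The lower bound on the new zeros keeps
    them distinct through the induction; that they avoid the old points matters when those are zeros
    of the derivative too. *)
Lemma rolle_path g x s : (forall z, U z -> derivable g z 1) ->
  path <%R x s -> (forall z, z \in x :: s -> U z /\ g z = 0) ->
  exists t, [/\ size t = size s, uniq t, {in t, forall z, x < z} &
    forall z, z \in t -> [/\ U z, g^`() z = 0 & z \notin x :: s]].
Proof.
move=> dg; elim: s x => [|y s IH] x /=; first by exists [::].
move=> /andP[xy ys] g0.
have [|t [szt ut yt gt]] := IH _ ys.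
  by move=> z zs; apply: g0; rewrite in_cons zs orbT.
have [Ux gx] := g0 x (mem_head _ _).
have [Uy gy] : U y /\ g y = 0 by apply: g0; rewrite !inE eqxx orbT.
have Uxy z : x <= z <= y -> U z by exact: itvU.
have [z zxy [_ dz]] : exists2 z, z \in `]x, y[%R & is_derive z 1 g 0.
  apply: Rolle => //; last by rewrite gx gy.
    by move=> z; rewrite in_itv /= => /andP[xz zy]; apply/dg/Uxy; rewrite !ltW.
  apply: derivable_within_continuous => z; rewrite in_itv /= => zxy.
  exact/dg/Uxy.
move: zxy; rewrite in_itv /= => /andP[xz zy].
have lt_y w : w \in s -> y < w.
  by move=> ws; move/(order_path_min lt_trans)/allP: ys; exact.
exists (z :: t); split=> /=.
- by rewrite szt.
- rewrite ut andbT; apply/negP => /yt; rewrite ltNge.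
  by rewrite (ltW zy).
- move=> w; rewrite inE => /predU1P[->//|/yt]; exact: lt_trans.
- move=> w; rewrite inE => /predU1P[->|wt].
    split; first by apply: Uxy; rewrite !ltW.
      by rewrite derive1E.
    rewrite !inE !negb_or gt_eqF//= lt_eqF//=; apply/negP => /lt_y.
    by rewrite ltNge (ltW zy).
  have [Uw gw ws] := gt _ wt; split=> //.
  by rewrite inE negb_or ws andbT gt_eqF// (lt_trans xy)// yt.
Qed.

Lemma rolle_seq g s n : (forall z, U z -> derivable g z 1) ->
  uniq s -> size s = n.+1 -> (forall z, z \in s -> U z /\ g z = 0) ->
  exists t, [/\ size t = n, uniq t &
    forall z, z \in t -> [/\ U z, g^`() z = 0 & z \notin s]].
Proof.
move=> dg us szs s0.
have : sorted <%R (sort <=%R s) by rewrite sort_lt_sorted.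
have : size (sort <=%R s) = n.+1 by rewrite size_sort.
have : sort <=%R s =i s by exact: mem_sort.
case: (sort _ _) => [//|x s'] ss' /= [sz'] ps'.
have [|t [szt ut _ gt]] := rolle_path dg ps'.
  by move=> z; rewrite ss'; exact: s0.
exists t; split=> //; first by rewrite szt.
by move=> z /gt; rewrite ss'.
Qed.

Lemma rolle_iter n g s : (forall z, U z -> nderivable n g z) ->
  uniq s -> (n < size s)%N -> (forall z, z \in s -> U z /\ g z = 0) ->
  exists2 z, U z & g^`(n) z = 0.
Proof.
elim: n g s => [|n IH] g s dg us szs s0.
  case: s us szs s0 => [//|x s] _ _ /(_ x (mem_head _ _))[Ux gx].
  by exists x.
have [||t [szt ut gt]] := @rolle_seq g s (size s).-1 _ us _ s0.
- by move=> z /dg; exact: nderivable_derivable.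
- by rewrite prednK//; apply: leq_trans szs.
have [||z zt|z Uz gz] := IH g^`() t _ ut.
- by move=> z /dg /nderivableSP[].
- by rewrite szt -ltnS prednK//; apply: leq_trans szs.
- by have [] := gt z zt.
- by exists z => //; rewrite derive1nSr.
Qed.

(** The [n.+1] double zeros and the [n] Rolle points between them are [(2 * n).+1] distinct zeros of
    the derivative, to which iterated Rolle applies. *)
Lemma rolle_double n g s : (forall z, U z -> nderivable (2 * n).+1 g z) ->
  uniq s -> size s = n.+1 ->
  (forall z, z \in s -> [/\ U z, g z = 0 & g^`() z = 0]) ->
  exists2 z, U z & g^`((2 * n).+1) z = 0.
Proof.
move=> dg us szs s0.
have [||t [szt ut gt]] := @rolle_seq g s n _ us szs.
- by move=> z /dg; exact: nderivable_derivable.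
- by move=> z /s0[].
have [||||z Uz gz] := @rolle_iter (2 * n)%N g^`() (t ++ s).
- by move=> z /dg /nderivableSP[].
- rewrite cat_uniq ut us andbT /=; apply/hasPn => z zs.
  by apply/negP => /gt[_ _]; rewrite zs.
- by rewrite size_cat szt szs; lia.
- by move=> z; rewrite mem_cat => /orP[/gt[]|/s0[]].
- by exists z => //; rewrite derive1nSr.
Qed.

End Rolle.

(** * The quadratic form of divided differences as a single Taylor coefficient *)

Definition divdiff (R : realType) (f : R -> R) (x y : R) : R :=
  if x == y then f^`()%classic x else (f x - f y) / (x - y).

(** Translation preserves the coefficient in top degree, so that of the interpolant can be read at
    whichever point Rolle provides. *)
Lemma coef_comp_XaddC_top (R : realType) (H : {poly R}) y n :
  (size H <= n.+1)%N -> (H \Po (y%:P + 'X))`_n = H`_n.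
Proof.
have szN : size (y%:P + 'X) = 2 by rewrite addrC size_XaddC.
rewrite leq_eqVlt ltnS => /orP[/eqP szH|szH]; last first.
  by rewrite !nth_default ?size_comp_poly2.
have -> : n = (size H).-1 by rewrite szH.
rewrite -[in LHS](size_comp_poly2 H szN) -!lead_coefE lead_coef_comp ?szN//.
by rewrite addrC lead_coefXaddC expr1n mulr1.
Qed.

Lemma coefM3_low (R : realType) (A B C : {poly R}) i :
  A`_0 = 0 -> B`_0 = 0 -> (i <= 1)%N -> (A * B * C)`_i = 0.
Proof.
move=> A0 B0 i1; rewrite coefM big1 // => j _.
have j1 : (j <= 1)%N by apply: leq_trans i1; rewrite -ltnS.
rewrite coefM; case: j j1 => -[|[|//]] /= _ _; rewrite !big_ord_recr big_ord0 /=;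
  by rewrite ?A0 ?B0 !(mul0r, mulr0, addr0).
Qed.

Section DividedDifferenceForm.
Variables (R : realType) (U : set R) (n : nat) (lambda : 'I_n.+1 -> R).
Hypotheses (itvU : is_interval U) (lambdaU : forall i, U (lambda i)).
Hypothesis lambda_inj : injective lambda.
Variable f : R -> R.
Hypothesis nf : forall x, U x -> nderivable (2 * n).+1 f x.

(** A Lagrange basis polynomial up to scaling, kept monic so that products of two of them have top
    coefficient 1. *)
Definition omit (i : 'I_n.+1) : {poly R} :=
  \prod_(a <- [seq lambda m | m <- enum (predC1 i)]) ('X - a%:P).

Lemma size_omit i : size (omit i) = n.+1.
Proof. by rewrite size_prod_XsubC size_map -cardE cardC1 card_ord. Qed.

Lemma monic_omit i : omit i \is monic.
Proof. exact: monic_prod_XsubC. Qed.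

Lemma omit_root i m : i != m -> (omit i).[lambda m] = 0.
Proof.
move=> im; apply/rootP; rewrite root_prod_XsubC; apply: map_f.
by rewrite mem_enum !inE eq_sym.
Qed.

(** For [i = j] this is the tangent line, which agrees with [f] to first order as a double node
    demands. *)
Definition secant i j : {poly R} :=
  (f (lambda i))%:P + divdiff f (lambda i) (lambda j) *: ('X - (lambda i)%:P).

Lemma secantl i j : (secant i j).[lambda i] = f (lambda i).
Proof. by rewrite /secant !hornerE subrr mulr0 addr0. Qed.

Lemma secantr i j : (secant i j).[lambda j] = f (lambda j).
Proof.
rewrite /secant /divdiff !hornerE; case: eqVneq => [->|ij].
  by rewrite subrr mulr0 addr0.
by rewrite -(opprB (lambda i)) mulrN divfK ?subr_eq0// opprB addrC subrK.
Qed.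

(* [H] is the Hermite interpolant of [f * q ^+ 2] with double nodes at the
   [lambda m], so that the left-hand side is the confluent divided difference of
   [f * q ^+ 2]. *)
Lemma divdiff_form (c : 'I_n.+1 -> R) : exists2 x, U x &
  forall F, jet (2 * n).+1 f x F ->
  \sum_i \sum_j c i * c j * divdiff f (lambda i) (lambda j) =
  (F * ((\sum_i c i *: omit i) \Po (x%:P + 'X)) ^+ 2)`_(2 * n).+1.
Proof.
pose q := \sum_i c i *: omit i.
pose H := \sum_i \sum_j (c i * c j) *: (omit i * omit j * secant i j).
pose phi z := f z * (q ^+ 2).[z] + (- H).[z].
have HE : H`_(2 * n).+1 = \sum_i \sum_j c i * c j * divdiff f (lambda i) (lambda j).
  rewrite coef_sum; apply: eq_bigr => i _; rewrite coef_sum; apply: eq_bigr => j _.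
  rewrite coefZ; congr (_ * _).
  have oo : omit i * omit j \is monic by rewrite monicMl ?monic_omit.
  have szo : size (omit i * omit j) = (2 * n).+1.
    by rewrite size_Mmonic ?(monic_neq0 (monic_omit i)) ?monic_omit// !size_omit; lia.
  rewrite /secant mulrDr coefD coefMC nth_default ?szo// mul0r add0r.
  rewrite -scalerAr coefZ mulrBr coefB coefMX coefMC /=.
  rewrite [X in _ - X * _]nth_default ?szo// mul0r subr0.
  by move/monicP: oo; rewrite lead_coefE szo /= => ->; rewrite mulr1.
have szH : (size H <= (2 * n).+2)%N.
  apply: (leq_trans (size_sum _ _ _)); apply/bigmax_leqP => i _.
  apply: (leq_trans (size_sum _ _ _)); apply/bigmax_leqP => j _.
  apply: leq_trans (size_scale_leq _ _) _.
  apply: leq_trans (size_polyMleq _ _) _.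
  have s1 : (size (omit i * omit j)%R <= (2 * n).+1)%N.
    by apply: leq_trans (size_polyMleq _ _) _; rewrite !size_omit; lia.
  have s2 : (size (secant i j) <= 2)%N.
    apply: leq_trans (size_polyD _ _) _; rewrite geq_max.
    rewrite (leq_trans (size_polyC_leq1 _))//=.
    by apply: leq_trans (size_scale_leq _ _) _; rewrite size_XsubC.
  by move: s1 s2; lia.
have jphi k x F : jet k f x F -> jet k phi x
    (F * (q \Po (x%:P + 'X)) ^+ 2 - (H \Po (x%:P + 'X))).
  move=> jF; have := jetD (jetM jF (jet_poly k x (q ^+ 2))) (jet_poly k x (- H)).
  by rewrite rmorphXn (raddfN (comp_poly _)).
have phi0 m i : (i <= 1)%N -> phi^`(i)%classic (lambda m) = 0.
  move=> i1; have nf1 := nderivableW (isT : 1 <= (2 * n).+1)%N (nf (lambdaU m)).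
  have [F jF] := nderivable_jet nf1.
  have [_ ->] := jphi _ _ _ jF; last by [].
  set N := (lambda m)%:P + 'X.
  have N0 (p : {poly R}) : (p \Po N)`_0 = p.[lambda m].
    by rewrite -horner_coef0 horner_comp /N !hornerE.
  have -> : q \Po N = \sum_i c i *: (omit i \Po N).
    by rewrite linear_sum; apply: eq_bigr => k _; rewrite linearZ.
  have -> : H \Po N = \sum_i \sum_j (c i * c j) *:
      ((omit i \Po N) * (omit j \Po N) * (secant i j \Po N)).
    rewrite linear_sum; apply: eq_bigr => k _.
    rewrite linear_sum; apply: eq_bigr => l _.
    by rewrite linearZ /= !rmorphM.
  have -> : (\sum_i c i *: (omit i \Po N)) ^+ 2 =
      \sum_i \sum_j (c i * c j) *: ((omit i \Po N) * (omit j \Po N)).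
    rewrite expr2 mulr_suml; apply: eq_bigr => k _.
    rewrite mulr_sumr; apply: eq_bigr => l _.
    by rewrite -scalerAl -scalerAr scalerA.
  rewrite mulr_sumr -sumrB coef_sum big1 ?mul0rn// => k _.
  rewrite mulr_sumr -sumrB coef_sum big1 // => l _.
  set A := omit k \Po N; set B := omit l \Po N; set C := F - (secant k l \Po N).
  rewrite (_ : _ - _ = (c k * c l) *: (A * B * C)); last first.
    by rewrite /C -!mul_polyC polyCM; ring.
  rewrite coefZ.
  suff -> : (A * B * C)`_i = 0 by rewrite mulr0.
  have F0 : F`_0 = f (lambda m) by case: jF => _ /(_ 0%N isT).
  have A0 : k != m -> A`_0 = 0 by move=> km; rewrite N0 omit_root.
  have B0 : l != m -> B`_0 = 0 by move=> lm; rewrite N0 omit_root.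
  (* A double zero arises in each case: [A] vanishes at the origin unless [k = m], [B] unless
     [l = m], and the interpolation error [C] if [k = m] or [l = m]. When [k = l = m], tangency
     gives [C] a double zero by itself. *)
  have [km|/A0 Ak] := eqVneq k m; have [lm|/B0 Bl] := eqVneq l m; last 1 first.
  - exact: coefM3_low.
  - have C0 : C`_0 = 0 by rewrite coefB N0 F0 km secantl subrr.
    have C1 : C`_1 = 0.
      rewrite coefB km lm /secant linearD /= comp_polyC linearZ /= linearB /=.
      rewrite comp_polyX comp_polyC coefD coefZ !coefB coefD !coefC coefX /=.
      rewrite /divdiff eqxx; case: jF => _ /(_ 1%N isT); rewrite derive1n1 mulr1n => ->.
      by ring.
    rewrite mulrC coefM big1 // => j _.
    have : (j <= 1)%N by apply: leq_trans i1; rewrite -ltnS.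
    by case: (nat_of_ord j) => [|[|//]] _; rewrite ?C0 ?C1 mul0r.
  - rewrite [A * B]mulrC mulrAC; apply: coefM3_low => //.
    by rewrite coefB N0 F0 km secantl subrr.
  - rewrite mulrAC; apply: coefM3_low => //.
    by rewrite coefB N0 F0 lm secantr subrr.
have [||||x Ux phix] := @rolle_double _ U itvU n phi (codom lambda).
- move=> z /nf /nderivable_jet[F /jphi []//].
- by rewrite /codom map_inj_uniq ?enum_uniq.
- by rewrite size_codom card_ord.
- move=> z /codomP[m ->]; split; first exact: lambdaU.
    by have := phi0 m 0%N isT.
  by have := phi0 m 1%N isT; rewrite derive1n1.
(* The vanishing derivative of [phi] equates the coefficients of order [(2 * n).+1] in the
   expansions at [x] of [f * q ^+ 2] and of [H]. *)
exists x => // F /jphi[_ /(_ _ (leqnn _))]; rewrite phix => /esym/eqP.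
rewrite mulrn_eq0 gtn_eqF ?fact_gt0//= coefB subr_eq0 => /eqP ->.
by rewrite coef_comp_XaddC_top// HE.
Qed.

End DividedDifferenceForm.

(** * Signs, and the passage from the matrix to the quadratic form *)

Lemma deriv_same_sign (R : realType) (U : set R) (f : R -> R) (x y : R) :
  is_interval U -> (forall z, U z -> nderivable 2 f z) ->
  (forall z, U z -> f^`()%classic z != 0) -> U x -> U y ->
  0 < f^`()%classic x * f^`()%classic y.
Proof.
move=> itvU nf f'0; wlog xy : x y / x <= y.
  move=> H Ux Uy; case: (leP x y) => [xy|/ltW yx]; first exact: H.
  by rewrite mulrC; exact: H.
move=> Ux Uy; rewrite ltNge; apply/negP => neg.
have Uz z : z \in `[x, y]%R -> U z by rewrite in_itv; exact: itvU Ux Uy z.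
(* The second derivative makes the first one continuous, so the intermediate value theorem applies
   to it. *)
have fc : {within `[x, y], continuous f^`()%classic}.
  apply: derivable_within_continuous => z /Uz /nf /nderivableSP[_ _].
  exact: nderivable_derivable.
have [|c /Uz /f'0] := IVT (v := 0) xy fc; last by move=> + c0; rewrite c0 eqxx.
rewrite ge_min le_max; case: (ltgtP 0 (f^`()%classic x)) => [x0|x0|//].
  by move: neg; rewrite pmulr_rle0// => ->; rewrite orbT.
by move: neg; rewrite nmulr_rle0// => ->; rewrite orbT.
Qed.

(** Used to give every divided difference the constant sign of the derivative, which identifies the
    square roots in the matrix. *)
Lemma divdiff_mean (R : realType) (U : set R) (f : R -> R) (x y : R) :
  is_interval U -> (forall z, U z -> derivable f z 1) -> U x -> U y ->
  exists2 z, U z & divdiff f x y = f^`()%classic z.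
Proof.
move=> itvU df; wlog xy : x y / x <= y.
  move=> H Ux Uy; case: (leP x y) => [xy|/ltW yx]; first exact: H.
  have [z Uz e] := H _ _ yx Uy Ux; exists z => //; rewrite -e /divdiff eq_sym.
  case: eqVneq => [->//|xy].
  by rewrite -(opprB (f y)) -(opprB y) invrN mulrNN.
move=> Ux Uy; rewrite /divdiff; move: xy; rewrite le_eqVlt.
case: eqVneq => [->|xNy /= xy]; first by exists y.
have Uz z : x <= z <= y -> U z by exact: itvU.
have [|z|z zxy fxy] := MVT (f := f) (df := f^`()%classic) xy.
- move=> z; rewrite in_itv /= => /andP[xz zy].
  have dz : derivable f z 1 by apply/df/Uz; rewrite !ltW.
  by apply: DeriveDef => //; rewrite derive1E.
- apply: derivable_within_continuous => w; rewrite in_itv /= => /Uz; exact: df.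
exists z.
  by move: zxy; rewrite in_itv /= => /andP[xz zy]; apply: Uz; rewrite !ltW.
by rewrite -(opprB (f y)) fxy -(opprB y x) invrN mulrNN mulfK// subr_eq0 eq_sym.
Qed.

Theorem proposition2 (R : realType) (d : nat) (d_gt0 : (0 < d)%N)
    (U : set R) (openU : open U) (itvU : is_interval U)
    (lambda : 'I_d.+1 -> R) (lambdaU : forall i, U (lambda i))
    (lambda_inj : injective lambda)
    (f : R -> R) (Pf : Pclass d U f) :
  forall mu : R, eigenvalue (dquot_mx f lambda) mu -> 0 <= mu.
Proof.
move=> mu /eigenvalueP[v vM v0].
have [nf f'0 Sf] := Pf.
have df z : U z -> derivable f z 1 by move=> /nf; exact: nderivable_derivable.
have nf2 z : U z -> nderivable 2 f z by move=> /nf; apply: nderivableW; lia.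
have fs x y : U x -> U y -> 0 < f^`()%classic x * f^`()%classic y.
  exact: deriv_same_sign.
pose e := Num.sg (f^`()%classic (lambda ord0)).
have e2 : e * e = 1.
  by rewrite -expr2 sqr_sg f'0.
have ef z : U z -> 0 < e * f^`()%classic z.
  move=> Uz; rewrite -sgr_gt0 sgrM sgr_id -sgrM sgr_gt0.
  exact: fs.
(* The diagonal congruence; the sign [e] makes the argument of the root positive. *)
pose t i := (Num.sqrt (e * f^`()%classic (lambda i)))^-1.
have ME i j : dquot_mx f lambda i j =
    e * divdiff f (lambda i) (lambda j) * t i * t j.
  have Di := ef _ (lambdaU i); have Dj := ef _ (lambdaU j).
  rewrite mxE -mulrA /t; case: (eqVneq i j) => [<-|ij].
    rewrite /divdiff eqxx -invfM -expr2 sqr_sqrtr ?ltW// divff//.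
    by rewrite gt_eqF.
  have [z Uz Lz] := divdiff_mean itvU df (lambdaU i) (lambdaU j).
  have Lij : divdiff f (lambda i) (lambda j) =
      (f (lambda i) - f (lambda j)) / (lambda i - lambda j).
    by rewrite /divdiff (inj_eq lambda_inj) (negPf ij).
  rewrite -Lij -invfM -sqrtrM ?ltW//.
  rewrite (_ : e * _ * (e * _) =
      f^`()%classic (lambda i) * f^`()%classic (lambda j)); last first.
    by rewrite mulrACA e2 mul1r.
  rewrite sqrtrM ?sqr_ge0// sqrtrV; last exact/ltW/fs.
  (* The root of the squared quotient is its absolute value, which is [e] times the divided
     difference since that product is positive. *)
  congr (_ / _); rewrite -[LHS]ger0_norm ?sqrtr_ge0//.
  have eL : 0 < e * divdiff f (lambda i) (lambda j) by rewrite Lz ef.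
  rewrite -(gtr0_norm eL) sqrtr_sqr normr_id normrM.
  suff -> : `|e| = 1 by rewrite mul1r.
  by rewrite normr_sg f'0.
pose c i := v 0 i * t i.
have vMv : mu * \sum_i v 0 i ^+ 2 =
    e * \sum_i \sum_j c i * c j * divdiff f (lambda i) (lambda j).
  transitivity (\sum_j (v *m dquot_mx f lambda) 0 j * v 0 j).
    rewrite vM mulr_sumr; apply: eq_bigr => j _.
    by rewrite mxE expr2 mulrA.
  rewrite exchange_big mulr_sumr; apply: eq_bigr => j _.
  rewrite mxE mulr_suml mulr_sumr; apply: eq_bigr => i _.
  by rewrite ME /c; ring.
have S0 : 0 < \sum_i v 0 i ^+ 2.
  have [i vi] := rV0Pn _ v0.
  rewrite (bigD1 i)//= ltr_wpDr ?sumr_ge0// ?exprn_even_gt0//.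
  by move=> k _; exact: sqr_ge0.
rewrite -(pmulr_lge0 _ S0) vMv.
have [x Ux] := divdiff_form itvU lambdaU lambda_inj nf c.
have [F jF] := nderivable_jet (nf _ Ux).
move=> /(_ _ jF) ->.
have F1 : F`_1 = f^`()%classic x.
  by case: jF => _ /(_ 1%N isT); rewrite derive1n1 mulr1n => ->.
have := ef _ Ux; rewrite -F1 => eF1.
(* Multiplying by the positive number [e] times the linear coefficient of [F] removes the sign, as
   [e * e = 1]. *)
rewrite -(pmulr_rge0 _ eF1) mulrACA e2 mul1r.
apply: pade_form_ge0.
  move=> k kd; have [s Ss s0] := Sf _ Ux k kd.
  have k2d : ((2 * k).+1 <= (2 * d).+1)%N.
    by case/andP: kd => _ kd; rewrite ltnS leq_mul2l kd orbT.
  have [p [q [szp szq q0 Fq Fqn]]] := schwarzian_coef Ss (jetW k2d jF).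
  (* The weight is the Schwarzian derivative over the factorial that converts a derivative into a
     Taylor coefficient. *)
  exists p, q, (s / ((2 * k).+1)`!%:R); split=> //; split=> //.
  by rewrite divr_ge0.
rewrite size_comp_poly2; last by rewrite addrC size_XaddC.
apply: (leq_trans (size_sum _ _ _)); apply/bigmax_leqP => i _.
by apply: leq_trans (size_scale_leq _ _) _; rewrite size_omit.
Qed.
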